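(* Let $N\in\mathbb{N}=\{1,2,\ldots\}$. (i) For any $k\in\mathbb{Z}_+=\{0,1,2,\ldots\}$ and $s\in\mathbb{R}$, there exists a constant $\gamma_N^{s,k}\ge 0$ such that $$\bigl(|x|_N^{k-s}\,|\nabla_N^k[|x|_N^s]|_{N^k}\bigr)^2=\gamma_N^{s,k}\quad\text{for all } x\in\mathbb{R}^N\setminus\{0\}.$$ (ii) For any $k\in\mathbb{N}$, there exists a constant $\ell_N^k>0$ such that $$\bigl(|x|_N^{k}\,|\nabla_N^k[\log|x|_N]|_{N^k}\bigr)^2=\ell_N^k\quad\text{for all } x\in\mathbb{R}^N\setminus\{0\}.$$
   Context: $|x|_N=(x_1^2+\cdots+x_N^2)^{1/2}$ is the Euclidean norm on $\mathbb{R}^N$; $\log$ is the natural logarithm. Let $I_N=\{1,\ldots,N\}$. For $i=(i_1,\ldots,i_k)\in I_N^k$ put $D_i=\frac{\partial}{\partial x_{i_1}}\cdots\frac{\partial}{\partial x_{i_k}}$. For a smooth real function $u$ on a domain $\Omega\subset\mathbb{R}^N$, $\nabla_N^k u(x)=(D_iu(x))_{i\in I_N^k}$ and $|\nabla_N^k u(x)|_{N^k}=\bigl(\sum_{i\in I_N^k}(D_iu(x))^2\bigr)^{1/2}$ (sum over all ordered $k$-tuples of indices); for $k=0$, $|\nabla_N^0u(x)|_1=|u(x)|$. *)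

(* Defs.v *)
From HB Require Import structures.
From mathcomp Require Import all_boot all_order all_algebra.
From mathcomp Require Import all_classical all_reals all_analysis.
Set Implicit Arguments. Unset Strict Implicit. Unset Printing Implicit Defensive.
Import Order.TTheory GRing.Theory Num.Theory.
Import numFieldNormedType.Exports.
Local Open Scope ring_scope.

Definition enorm (R : realType) (N : nat) (x : 'rV[R]_N) : R :=
  Num.sqrt (\sum_(i < N) x ord0 i ^+ 2).

Definition ebasis (R : realType) (N : nat) (i : 'I_N) : 'rV[R]_N :=
  delta_mx ord0 i.

Definition pderiv (R : realType) (N : nat) (i : 'I_N) (u : 'rV[R]_N -> R)
  : 'rV[R]_N -> R := fun x => derive u x (ebasis R i).

Definition Dmulti (R : realType) (N : nat) (s : seq 'I_N) (u : 'rV[R]_N -> R)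
  : 'rV[R]_N -> R := foldr (@pderiv R N) u s.

Definition gradk_norm (R : realType) (N k : nat) (u : 'rV[R]_N -> R)
  (x : 'rV[R]_N) : R :=
  Num.sqrt (\sum_(t : k.-tuple 'I_N) (Dmulti (tval t) u x) ^+ 2).

(* Main.v *)
(* Let B_k(u, v) be the sum of D_t u * D_t v over the k-tuples t of indices.
   Since the Laplacian commutes with partial derivatives, Bochner's formula
     Lap B_k(u, v) = B_k(Lap u, v) + B_k(u, Lap v) + 2 B_(k+1)(u, v)
   holds. The Laplacian maps |x|^a to a multiple of |x|^(a-2), and log|x| to a
   multiple of |x|^(-2), so if u, v are among these functions, with degrees a and
   b (the degree of log|x| being 0), induction on k >= 1 shows that B_k(u, v) is
   a multiple of |x|^(a+b-2k). For u = v = log|x| the multiple is not 0: by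
   Euler's relation, the vanishing of all derivatives of order k >= 2 would force
   that of all derivatives of order k - 1, hence finally of x/|x|^2. *)
Require Import Defs.
From HB Require Import structures.
From mathcomp Require Import all_boot all_order all_algebra.
From mathcomp Require Import all_classical all_reals all_analysis.
From mathcomp Require Import ring.
Import Order.TTheory GRing.Theory Num.Theory.
Import numFieldNormedType.Exports.
Local Open Scope ring_scope.

(** * Directional derivatives by restriction to a line *)

(** The two difference quotients are the same function, so directional derivatives reduce to
    one-variable calculus. *)
Lemma is_derive_line (R : realType) (V : normedModType R) (f : V -> R)
    (x v : V) (df : R) :
  is_derive (0 : R) (1 : R) (fun h => f (h *: v + x)) df <->
  is_derive x v f df.
Proof.
have E : (fun h : R => h^-1 *: ((f \o shift x) (h *: v) - f x)) =
   (fun h : R => h^-1 *: (((fun h => f (h *: v + x)) \o shift (0 : R))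
       (h *: (1 : R)) - (fun h => f (h *: v + x)) 0)).
  by apply/funext => h /=; rewrite addr0 scale0r add0r /GRing.scale /= mulr1.
split=> -[exg vg].
  by split; [rewrite /derivable E; exact: exg | rewrite /derive E; exact: vg].
by split; [rewrite /derivable -E; exact: exg | rewrite /derive -E; exact: vg].
Qed.

Lemma is_derive_comp_real (R : realType) (V : normedModType R) (f : R -> R)
    (g : V -> R) (x v : V) (df dg : R) :
  is_derive (g x) 1 f df -> is_derive x v g dg ->
  is_derive x v (f \o g) (df * dg).
Proof.
move=> fE /is_derive_line gE; apply/is_derive_line.
by apply: (@is_derive1_comp _ f _ 0) gE; rewrite scale0r add0r.
Qed.

Lemma big_tuple_cons (V : nmodType) (T : finType) (k : nat) (F : seq T -> V) :
  \sum_(t : k.+1.-tuple T) F t = \sum_(i : T) \sum_(t : k.-tuple T) F (i :: t).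
Proof.
rewrite pair_bigA /=.
rewrite (reindex (fun p : T * k.-tuple T => cons_tuple p.1 p.2))//=.
exists (fun t => (thead t, behead_tuple t)) => [[i t] _|t _] /=.
  by congr (_, _); apply: val_inj.
by rewrite [RHS]tuple_eta; apply: val_inj.
Qed.

Section RadialExpressions.
Variables (R : realType) (N : nat).
Implicit Types (x : 'rV[R]_N) (i j : 'I_N) (a b c : R) (s : seq 'I_N).

(** * The Euclidean norm and its partial derivatives *)

Lemma enorm_gt0 x : x != 0 -> 0 < enorm x.
Proof.
move=> x0; rewrite /enorm sqrtr_gt0 lt_neqAle sumr_ge0 ?andbT; last first.
  by move=> i _; exact: sqr_ge0.
apply: contraNneq x0 => /esym/psumr_eq0P h; apply/eqP/rowP => i.
by apply/eqP; rewrite mxE -sqrf_eq0; apply/eqP/h => // j _; exact: sqr_ge0.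
Qed.

Lemma enorm_sqr x : enorm x ^+ 2 = \sum_i x ord0 i ^+ 2.
Proof. by rewrite sqr_sqrtr// sumr_ge0// => i _; exact: sqr_ge0. Qed.

Lemma is_derive_coord x i j :
  is_derive x (ebasis R i) (fun y : 'rV[R]_N => y ord0 j) (i == j)%:R.
Proof.
apply/is_derive_line.
have -> : (fun h : R => (h *: ebasis R i + x) ord0 j) =
    (fun h => h * (i == j)%:R + x ord0 j).
  by apply/funext => h; rewrite !mxE eqxx /= eq_sym.
apply: is_derive_eq.
by rewrite /GRing.scale /=; ring.
Qed.

(** Along the line [h *: e_i + x] the squared norm is the quadratic [h^2 + 2 h x_i + |x|^2], whose
    square root is differentiated at [h = 0]. *)
Lemma is_derive_enorm x i : x != 0 ->
  is_derive x (ebasis R i) (@enorm R N) (x ord0 i / enorm x).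
Proof.
move=> x0; have r0 := enorm_gt0 _ x0; apply/is_derive_line.
have -> : (fun h : R => enorm (h *: ebasis R i + x)) =
    Num.sqrt \o (fun h => h ^+ 2 + h * (x ord0 i *+ 2) + enorm x ^+ 2).
  apply/funext => h; rewrite enorm_sqr /enorm /=; congr Num.sqrt.
  rewrite (bigD1 i)//= [in RHS](bigD1 i)//= !mxE !eqxx /= !addrA; congr (_ + _).
    by rewrite mulr1; ring.
  by apply: eq_bigr => j ji; rewrite !mxE (negbTE ji) /= mulr0 add0r.
apply: (is_derive_eq (f' := (2 * enorm x)^-1 * (x ord0 i *+ 2))).
  apply: is_derive1_comp.
    set y := _ + _; have -> : y = enorm x ^+ 2.
      by rewrite /y mul0r expr0n /= !add0r.
    rewrite -[in X in is_derive _ _ _ X](ger0_norm (ltW r0)) -sqrtr_sqr.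
    exact/is_derive1_sqrt/exprn_gt0.
  apply: is_derive_eq.
  by rewrite /GRing.scale /=; ring.
by field; rewrite lt0r_neq0.
Qed.

Lemma near_neq0 x : x != 0 -> \near x, x != 0.
Proof. by move=> x0; exact: (@cvgr_neq0 _ 'rV[R]_N _ (nbhs x) _ id x). Qed.

(* A class of functions on R^N \ {0} that contains the powers and the logarithm
   of the norm and is closed under partial derivatives. *)
Inductive expr :=
  | Cst of R
  | Crd of 'I_N
  | Pow of R
  | Log
  | Add of expr & expr
  | Mul of expr & expr.

Fixpoint eval (e : expr) x : R :=
  match e with
  | Cst c => c
  | Crd i => x ord0 i
  | Pow a => enorm x `^ a
  | Log => ln (enorm x)
  | Add e f => eval e x + eval f x
  | Mul e f => eval e x * eval f x
  end.

Fixpoint dx i (e : expr) : expr :=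
  match e with
  | Cst c => Cst 0
  | Crd j => Cst (i == j)%:R
  | Pow a => Mul (Cst a) (Mul (Crd i) (Pow (a - 2)))
  | Log => Mul (Crd i) (Pow (- 2))
  | Add e f => Add (dx i e) (dx i f)
  | Mul e f => Add (Mul (dx i e) f) (Mul e (dx i f))
  end.

(** * Formal derivatives and true derivatives *)

(** The origin is left out because [dx] need not give the derivative there. *)
Definition equiv e f := forall x, x != 0 -> eval e x = eval f x.

Lemma powRDneq0 x a b : x != 0 ->
  enorm x `^ (a + b) = enorm x `^ a * enorm x `^ b.
Proof. by move=> x0; rewrite powRD// (gt_eqF (enorm_gt0 _ x0)) implybT. Qed.

Lemma powRB2_sqr x a : x != 0 ->
  enorm x `^ (a - 2) * enorm x ^+ 2 = enorm x `^ a.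
Proof.
move=> x0; rewrite -powR_mulrn ?(ltW (enorm_gt0 _ x0))//.
by rewrite -powRDneq0// subrK.
Qed.

Lemma is_derive_eval e x i : x != 0 ->
  is_derive x (ebasis R i) (eval e) (eval (dx i e) x).
Proof.
move=> x0; have r0 := enorm_gt0 _ x0.
elim: e => [c|j|a||e ihe f ihf|e ihe f ihf] /=.
- exact: is_derive_cst.
- exact: is_derive_coord.
- apply: (is_derive_eq (is_derive_comp_real _ _ _ _ _ _ _ _
    (is_derive1_powR a r0) (is_derive_enorm x i x0))).
  (* One factor [1/|x|] comes from the derivative of the norm; it lowers the exponent from [a - 1]
     to [a - 2]. *)
  rewrite (_ : a - 2 = (a - 1) + (- 1)); last by ring.
  by rewrite [in RHS]powRDneq0// powR_inv1 ?ltW//; ring.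
- apply: (is_derive_eq (is_derive_comp_real _ _ _ _ _ _ _ _
    (is_derive1_ln r0) (is_derive_enorm x i x0))).
  rewrite (_ : - 2 = (- 1) + (- 1) :> R); last by ring.
  by rewrite [in RHS]powRDneq0// powR_inv1 ?ltW//; ring.
- exact: is_deriveD.
- apply: (is_derive_eq (is_deriveM ihe ihf)).
  by rewrite /GRing.scale /=; ring.
Qed.

(** The complement of the origin is open, and a derivative depends only on the values near the
    point. *)
Lemma equiv_dx i e f : equiv e f -> equiv (dx i e) (dx i f).
Proof.
move=> ef x x0.
have [_ <-] := is_derive_eval e x i x0; have [_ <-] := is_derive_eval f x i x0.
apply: near_eq_derive; apply: filterS (near_neq0 x x0) => y; exact: ef.
Qed.

(** Symmetry of second derivatives is read off the formal rules by induction on the expression. *)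
Lemma dxC i j e x : eval (dx i (dx j e)) x = eval (dx j (dx i e)) x.
Proof.
elim: e => [c|k|a||e ihe f ihf|e ihe f ihf] //=.
- by rewrite eq_sym; ring.
- by rewrite eq_sym; ring.
- by rewrite ihe ihf.
- by rewrite ihe ihf; ring.
Qed.

Lemma Dmulti_eval s e x : x != 0 ->
  Dmulti s (eval e) x = eval (foldr dx e s) x.
Proof.
elim: s x => [//|i s ih] x x0 /=; rewrite /pderiv.
have [_ <-] := is_derive_eval (foldr dx e s) x i x0.
apply: near_eq_derive; apply: filterS (near_neq0 x x0) => y; exact: ih.
Qed.

Definition Sum (F : 'I_N -> expr) : expr := \big[Add/Cst 0]_i F i.

Lemma eval_Sum F x : eval (Sum F) x = \sum_i eval (F i) x.
Proof. exact: (big_morph (fun e => eval e x)). Qed.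

Lemma dx_Sum i F : dx i (Sum F) = Sum (fun j => dx i (F j)).
Proof. exact: (big_morph (dx i)). Qed.

(** * The Laplacian and Bochner's formula *)

Definition lap e := Sum (fun i => dx i (dx i e)).

Lemma lap_dx i e : equiv (lap (dx i e)) (dx i (lap e)).
Proof.
move=> x x0; rewrite dx_Sum !eval_Sum; apply: eq_bigr => j _.
rewrite -[RHS]dxC; apply: equiv_dx => // y _; exact: dxC.
Qed.

(* The sum of [D_t u * D_t v] over the [k]-tuples [t]; see [eval_gradk_dot]. *)
Fixpoint gradk_dot k u v : expr :=
  if k is k'.+1 then Sum (fun i => gradk_dot k' (dx i u) (dx i v)) else Mul u v.

(** [gradk_dot] applies the first index innermost, [Dmulti] outermost; this reconciles the two
    orders. *)
Lemma foldr_dx_dx s i e : equiv (foldr dx (dx i e) s) (dx i (foldr dx e s)).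
Proof.
elim: s => [//|j s ih] /= x x0.
by rewrite dxC; apply: equiv_dx.
Qed.

Lemma eval_gradk_dot k u v x : x != 0 ->
  eval (gradk_dot k u v) x =
  \sum_(t : k.-tuple 'I_N) eval (foldr dx u t) x * eval (foldr dx v t) x.
Proof.
move=> x0; elim: k u v => [|k ih] u v /=.
  rewrite (big_pred1 [tuple])// => t; exact/esym/eqP/tuple0.
rewrite eval_Sum (big_tuple_cons _ _ k
  (fun t => eval (foldr dx u t) x * eval (foldr dx v t) x)).
apply: eq_bigr => i _; rewrite ih.
by apply: eq_bigr => t _; rewrite !foldr_dx_dx.
Qed.

Lemma gradk_norm_sqr k e x : x != 0 ->
  gradk_norm k (eval e) x ^+ 2 = eval (gradk_dot k e e) x.
Proof.
move=> x0; rewrite sqr_sqrtr; last by apply: sumr_ge0 => t _; exact: sqr_ge0.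
rewrite eval_gradk_dot//; apply: eq_bigr => t _.
by rewrite Dmulti_eval// expr2.
Qed.

Lemma equiv_gradk_dot k u u' v v' : equiv u u' -> equiv v v' ->
  equiv (gradk_dot k u v) (gradk_dot k u' v').
Proof.
elim: k u u' v v' => [|k ih] u u' v v' uu vv x x0 /=; first by rewrite uu ?vv.
by rewrite !eval_Sum; apply: eq_bigr => i _; apply: ih => //; exact: equiv_dx.
Qed.

(** Bochner's formula: for [k = 0] it is the product rule for the Laplacian, and the induction step
    applies it to [dx i u] and [dx i v], then commutes [lap] with [dx i]. *)
Lemma lap_gradk_dot k u v x : x != 0 ->
  eval (lap (gradk_dot k u v)) x =
  eval (gradk_dot k (lap u) v) x + eval (gradk_dot k u (lap v)) x +
  2 * eval (gradk_dot k.+1 u v) x.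
Proof.
move=> x0; elim: k u v => [|k ih] u v.
  rewrite /= !eval_Sum mulr_suml mulr_sumr mulr_sumr -!big_split /=.
  by apply: eq_bigr => i _; ring.
transitivity (\sum_i eval (lap (gradk_dot k (dx i u) (dx i v))) x).
  rewrite /lap eval_Sum /=; under eq_bigr do rewrite !dx_Sum eval_Sum.
  by rewrite exchange_big; apply: eq_bigr => i _; rewrite eval_Sum.
change (gradk_dot k.+2 u v) with
  (Sum (fun i => gradk_dot k.+1 (dx i u) (dx i v))).
rewrite !eval_Sum mulr_sumr -!big_split /=; apply: eq_bigr => i _.
rewrite ih; congr (_ + _ + _).
  by apply: equiv_gradk_dot => //; exact: lap_dx.
by apply: equiv_gradk_dot => //; exact: lap_dx.
Qed.

(** * Homogeneous radial functions *)

Definition homog a e := exists c, equiv e (Mul (Cst c) (Pow a)).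

(** The condition bears on the gradient so that the logarithm qualifies, with degree 0. *)
Definition radial a e :=
  exists c, forall i, equiv (dx i e) (Mul (Cst c) (Mul (Crd i) (Pow (a - 2)))).

Lemma homog_radial a e : homog a e -> radial a e.
Proof.
move=> [c eE]; exists (c * a) => i x x0.
by rewrite (equiv_dx i _ _ eE)//=; ring.
Qed.

Lemma radial_pow a : radial a (Pow a).
Proof. by exists a => i x x0. Qed.

Lemma radial_log : radial 0 Log.
Proof. by exists 1 => i x x0 /=; rewrite mul1r sub0r. Qed.

(** The divergence of [c |x|^(a-2) x] is [c (N + a - 2) |x|^(a-2)]. *)
Lemma radial_lap a e : radial a e -> homog (a - 2) (lap e).
Proof.
move=> [c eE]; exists (c * (N%:R + (a - 2))) => x x0; rewrite eval_Sum.
under eq_bigr do rewrite (equiv_dx _ _ _ (eE _))//= eqxx.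
transitivity (\sum_(i < N) (c * enorm x `^ (a - 2) +
   c * (a - 2) * (enorm x `^ (a - 2 - 2) * x ord0 i ^+ 2))).
  by apply: eq_bigr => i _; rewrite mulr1n; ring.
rewrite big_split /= sumr_const card_ord -!mulr_sumr -enorm_sqr.
by rewrite powRB2_sqr// -mulr_natl /=; ring.
Qed.

(** The induction generalizes over both functions and their degrees, since the hypothesis is also
    used with [lap u] or [lap v], of degree lowered by 2. *)
Lemma gradk_dot_radial k a b u v : radial a u -> radial b v ->
  homog (a + b - (k.+1 * 2)%:R) (gradk_dot k.+1 u v).
Proof.
elim: k a b u v => [|k ih] a b u v ru rv.
  have [c uE] := ru; have [d vE] := rv; exists (c * d) => x x0.
  rewrite /= eval_Sum /=; under eq_bigr do rewrite uE// vE//=.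
  transitivity (\sum_(i < N) (c * d * (enorm x `^ (a - 2) * (enorm x `^ (b - 2)
     * x ord0 i ^+ 2)))).
    by apply: eq_bigr => i _; ring.
  rewrite -!mulr_sumr -enorm_sqr powRB2_sqr//.
  by rewrite -powRDneq0//; congr (_ * _ `^ _); ring.
have ra := radial_lap _ _ ru; have rb := radial_lap _ _ rv.
have [c0 e0] := radial_lap _ _ (homog_radial _ _ (ih _ _ _ _ ru rv)).
have [c1 e1] := ih _ _ _ _ (homog_radial _ _ ra) rv.
have [c2 e2] := ih _ _ _ _ ru (homog_radial _ _ rb).
(* Bochner's formula solved for its last term; all the powers involved have the same exponent. *)
exists ((c0 - c1 - c2) / 2) => x x0.
have := lap_gradk_dot k.+1 u v x x0.
rewrite e0// e1// e2//=.
have -> : a - 2 + b - (k.+1 * 2)%:R = a + b - (k.+2 * 2)%:R :> R.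
  by rewrite !natrM -!natr1; ring.
have -> : a + (b - 2) - (k.+1 * 2)%:R = a + b - (k.+2 * 2)%:R :> R.
  by rewrite !natrM -!natr1; ring.
have -> : a + b - (k.+1 * 2)%:R - 2 = a + b - (k.+2 * 2)%:R :> R.
  by rewrite !natrM -!natr1; ring.
set B := eval _ _; set P := powR _ _ => E.
apply: (@mulfI _ 2) => //.
rewrite -[LHS](addKr (c1 * P + c2 * P)) -E /=.
by field.
Qed.

(* Euler's relation: [D_t log|x|] is homogeneous of degree [- |t|] if [t] is not
   empty, while [x . grad (log|x|) = 1]. *)
Lemma euler_log s :
  equiv (Sum (fun j => Mul (Crd j) (dx j (foldr dx Log s))))
    (Add (Cst (s == [::])%:R) (Mul (Cst (- (size s)%:R)) (foldr dx Log s))).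
Proof.
elim: s => [|i s ih] x x0.
  rewrite eval_Sum /=.
  under eq_bigr do rewrite mulrA -expr2.
  by rewrite -mulr_suml -enorm_sqr mulrC -(sub0r 2) powRB2_sqr// powRr0; ring.
(* Differentiating the relation along [x_i], the factor [x_i] yields one extra copy of the new
   derivative; moved to the right, it turns [- |s|] into [- (|s| + 1)]. *)
have := equiv_dx i _ _ ih x x0; rewrite dx_Sum !eval_Sum /= big_split /=.
rewrite (bigD1 i)//= eqxx mul1r big1 => [|j ji]; last first.
  by rewrite eq_sym (negbTE ji) mul0r.
under [X in _ + X = _]eq_bigr do rewrite dxC.
rewrite !addr0 mul0r !add0r -natr1 => E.
rewrite -[LHS](addKr (eval (dx i (foldr dx Log s)) x)) E; ring.
Qed.

(** Descent on the order: if the left side of Euler's relation vanishes, so does [D_s log|x|] for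
    nonempty [s], while for empty [s] the relation at [x0] reads [0 = 1]. *)
Lemma gradk_log_neq0 k x0 : x0 != 0 :> 'rV[R]_N ->
  ~ forall s, size s = k.+1 -> equiv (foldr dx Log s) (Cst 0).
Proof.
move=> x0n0; elim: k => [|k ih] H.
  have := euler_log [::] x0 x0n0; rewrite eval_Sum /= oppr0 mul0r addr0.
  rewrite big1 => [/eqP|i _]; first by rewrite eq_sym oner_eq0.
  by have /= -> := H [:: i] erefl x0 x0n0; rewrite mulr0.
apply: ih => s sk x x0'; have := euler_log s x x0'.
rewrite eval_Sum big1 => [|i _]; last by rewrite /= (H (i :: s)) ?mulr0//= sk.
rewrite /= sk; case: s sk => //= i s sk /esym/eqP.
by rewrite add0r mulf_eq0 oppr_eq0 pnatr_eq0 /= => /eqP.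
Qed.

End RadialExpressions.

Theorem theorem1p1 (R : realType) (N : nat) (hN : (0 < N)%N) :
  (forall (k : nat) (s : R), exists gamma : R, 0 <= gamma /\
     forall x : 'rV[R]_N, x != 0 ->
       (enorm x `^ (k%:R - s) *
          gradk_norm k (fun y : 'rV[R]_N => enorm y `^ s) x) ^+ 2 = gamma)
  /\
  (forall k : nat, (0 < k)%N -> exists l : R, 0 < l /\
     forall x : 'rV[R]_N, x != 0 ->
       (enorm x ^+ k *
          gradk_norm k (fun y : 'rV[R]_N => ln (enorm y)) x) ^+ 2 = l).
Proof.
(* A nonzero point, available since [N > 0], at which the signs of both constants are read off. *)
have [z z0] : exists z : 'rV[R]_N, z != 0.
  case: N hN => // n _; exists (const_mx 1); apply/eqP => /rowP/(_ ord0)/eqP.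
  by rewrite !mxE oner_eq0.
have powr_sqr x a : x != 0 -> (@enorm R N x `^ a) ^+ 2 = enorm x `^ (a *+ 2).
  by move=> x0; rewrite expr2 -powRDneq0// mulr2n.
split=> [k s|[//|k] _].
  have [c cE] : homog R N (s + s - (k * 2)%:R)
      (gradk_dot R N k (Pow R N s) (Pow R N s)).
    (* Order 0 is [|x|^s |x|^s] itself; the radial lemma starts at order 1. *)
    case: k => [|k]; last by apply: gradk_dot_radial; exact: radial_pow.
    by exists 1 => x x0 /=; rewrite mul0n subr0 mul1r powRDneq0.
  have cP x : x != 0 -> (enorm x `^ (k%:R - s) *
      gradk_norm k (fun y : 'rV[R]_N => enorm y `^ s) x) ^+ 2 = c.
    move=> x0; rewrite exprMn (gradk_norm_sqr _ _ k (Pow R N s))// cE//=.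
    rewrite powr_sqr//.
    (* The exponents [2 (k - s)] and [2 s - 2 k] cancel. *)
    rewrite mulrCA -powRDneq0// [X in _ `^ X](_ : _ = 0) ?powRr0 ?mulr1//.
    by rewrite natrM; ring.
  by exists c; split => //; rewrite -(cP z z0) sqr_ge0.
have [c cE] := gradk_dot_radial R N k _ _ _ _ (radial_log R N) (radial_log R N).
have cP x : x != 0 -> (enorm x ^+ k.+1 *
    gradk_norm k.+1 (fun y : 'rV[R]_N => ln (enorm y)) x) ^+ 2 = c.
  move=> x0; rewrite exprMn (gradk_norm_sqr _ _ k.+1 (Log R N))// cE//=.
  rewrite -exprM -powR_mulrn ?(ltW (enorm_gt0 _ _ _ x0))// mulrCA -powRDneq0//.
  rewrite [X in _ `^ X](_ : _ = 0) ?powRr0 ?mulr1//.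
  by ring.
exists c; split => //; rewrite lt_neqAle -{2}(cP z z0) sqr_ge0 andbT eq_sym.
(* If [c = 0], a sum of squares vanishes, hence so does every derivative of order [k + 1] away from
   the origin. *)
apply/eqP => c0; apply: (gradk_log_neq0 R N k z z0) => s sk x x0.
have /eqP := cE x x0; rewrite eval_gradk_dot//= c0 mul0r psumr_eq0; last first.
  by move=> t _; rewrite -expr2 sqr_ge0.
move=> /allP /(_ (Tuple (introT eqP sk))); rewrite mem_index_enum => /(_ isT).
by rewrite /= mulf_eq0 orbb => /eqP.
Qed.
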